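(* If $H$ is a linear hypergraph in which every hyperedge has cardinality at least $r$ and which has at least $r$ hyperedges, then $b_L(H)\ge\binom{r}{2}$.
   Context: A hypergraph $H$ consists of a finite vertex set $V(H)$ and a finite collection $E(H)$ of subsets of $V(H)$; it is linear if every two distinct hyperedges intersect in at most one vertex. Lazy burning: a set $B\subseteq V(H)$ is burned initially; in each subsequent round every unburned vertex $v$ for which some hyperedge $h\ni v$ has $h\setminus\{v\}$ entirely burned becomes burned. $B$ is a lazy burning set if eventually all vertices burn; $b_L(H)$ is the minimum size of a lazy burning set. *)

(* Defs.v *)
From mathcomp Require Import all_boot.

Set Implicit Arguments.
Unset Strict Implicit.
Unset Printing Implicit Defensive.

(* The vertex set is the whole finite type [T] and [E] is the set of           *)
(* hyperedges; isolated vertices, empty and singleton hyperedges are allowed.  *)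
(* A vertex forming a singleton hyperedge burns in the first round.            *)

Definition linear_hypergraph (T : finType) (E : {set {set T}}) : Prop :=
  {in E &, forall g h, g != h -> #|g :&: h| <= 1}.

Definition burn_round (T : finType) (E : {set {set T}}) (S : {set T}) :
    {set T} :=
  S :|: [set v | [exists h in E, (v \in h) && (h :\ v \subset S)]].

Definition burned (T : finType) (E : {set {set T}}) (B : {set T}) (t : nat) :
    {set T} :=
  iter t (burn_round E) B.

Definition lazy_burning_set (T : finType) (E : {set {set T}}) (B : {set T}) :
    Prop :=
  exists t, burned E B t = [set: T].

Lemma card_burned (T : finType) (E : {set {set T}}) (B : {set T}) (t : nat) :
  burned E B t.+1 != burned E B t -> t < #|burned E B t.+1|.
Proof.
have sub n : burned E B n \subset burned E B n.+1 by exact: subsetUl.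
elim: t => [|t IHt] neq.
  apply: leq_ltn_trans (leq0n _) (proper_card (A := burned E B 0) _).
  by rewrite properEneq eq_sym neq sub.
have lt : #|burned E B t.+1| < #|burned E B t.+2|.
  by apply: proper_card; rewrite properEneq eq_sym neq sub.
apply: leq_ltn_trans (IHt _) lt; apply: contra neq => /eqP eq_t.
by apply/eqP; rewrite /burned !iterS -!/(burned E B _) in eq_t *; rewrite eq_t.
Qed.

(* At least one vertex burns per round until the process stops, so [#|T|]      *)
(* rounds decide whether everything burns.                                     *)
Lemma lazy_burning_setP (T : finType) (E : {set {set T}}) (B : {set T}) :
  reflect (lazy_burning_set E B) (burned E B #|T| == [set: T]).
Proof.
apply: (iffP eqP) => [all_burned | [t all_burned]]; first by exists #|T|.
have fix_n : burned E B #|T|.+1 = burned E B #|T|.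
  apply/eqP; apply/negPn/negP => /card_burned.
  by rewrite ltnNge max_card.
have fixD m : burned E B (m + #|T|) = burned E B #|T|.
  by elim: m => // m IHm; rewrite addSn -fix_n /burned !iterS -!/(burned E B _) IHm.
apply/eqP; rewrite eqEsubset subsetT /= -(fixD t) -all_burned addnC.
elim: #|T| => [|n IHn]; first by rewrite add0n.
by apply: subset_trans IHn _; rewrite addSn; exact: subsetUl.
Qed.

Definition lazy_burning_number (T : finType) (E : {set {set T}}) : nat :=
  #|[arg min_(B < [set: T] | burned E B #|T| == [set: T]) #|B|]|.

Lemma lazy_burning_setT (T : finType) (E : {set {set T}}) :
  lazy_burning_set E [set: T].
Proof. by exists 0. Qed.

Lemma lazy_burning_number_min (T : finType) (E : {set {set T}}) :
  (exists2 B, lazy_burning_set E B & #|B| = lazy_burning_number E) /\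
  (forall B, lazy_burning_set E B -> lazy_burning_number E <= #|B|).
Proof.
rewrite /lazy_burning_number; case: arg_minnP => [|B burnB minB].
  exact/lazy_burning_setP/lazy_burning_setT.
split=> [|C /lazy_burning_setP]; last exact: minB.
by exists B => //; apply/lazy_burning_setP.
Qed.

(* Main.v *)
Require Import Defs.
From mathcomp Require Import all_boot zify.

Set Implicit Arguments.
Unset Strict Implicit.
Unset Printing Implicit Defensive.

(** Starting from a lazy burning set [B], one can select hyperedges one at a
    time so that each adds at most one vertex to the union of [B] and the
    hyperedges selected before: as long as that union is not everything, some
    hyperedge has exactly one vertex outside it.  After [r] steps the selected
    hyperedges cover at most [#|B| + r] vertices, whereas by linearity [r]
    hyperedges of size at least [r] cover at least [r + (r - 1) + ... + 1]. *)

Lemma burned_subset (T : finType) (E : {set {set T}}) (B S : {set T}) (t : nat) :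
  B \subset S -> burn_round E S \subset S -> burned E B t \subset S.
Proof.
move=> subBS closedS; elim: t => // t IHt.
apply: subset_trans closedS; rewrite /burned iterS -/(burned E B t).
apply/setUSS/subsetP => // v; rewrite !inE => /exists_inP[h hE /andP[vh sub]].
by apply/exists_inP; exists h => //; rewrite vh (subset_trans sub IHt).
Qed.

(** If the union [S] is not closed under a burning round, an edge that burns a vertex outside [S]
    works; if it is closed, it contains all that burns from [B]. *)
Lemma next_burning_edge (T : finType) (E F : {set {set T}}) (B : {set T}) :
  lazy_burning_set E B -> F \proper E ->
  exists2 h, h \in E :\: F & #|h :\: (B :|: cover F)| <= 1.
Proof.
move=> [t burnB] /properP[_ [g gE gF]]; set S := B :|: cover F.
have [/(burned_subset t (subsetUl B _)) | ] := boolP (burn_round E S \subset S).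
  (* Here [S] is the whole vertex set, so any unselected edge adds nothing. *)
  rewrite burnB => subTS; exists g; first by rewrite inE gF.
  by rewrite (_ : _ :\: _ = set0) ?cards0 //; apply/eqP;
     rewrite setD_eq0 (subset_trans (subsetT g)).
case/subsetPn=> v; rewrite in_setU => /orP[-> // | ].
rewrite inE => /exists_inP[h hE /andP[vh sub]] vS.
exists h; last first.
  rewrite -(cards1 v); apply: subset_leq_card; apply/subsetP => w.
  rewrite !in_setD in_set1 => /andP[wS wh]; apply: contraR wS => neq_wv.
  by apply: (subsetP sub); rewrite !inE neq_wv.
(* A selected edge lies inside [S], yet [h] contains [v], which is outside. *)
rewrite inE hE andbT; apply: contra vS => hF.
by rewrite inE; apply/orP; right; apply/bigcupP; exists h.
Qed.

Lemma burning_edge_selection (T : finType) (E : {set {set T}}) (B : {set T})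
    (k : nat) :
  lazy_burning_set E B -> k <= #|E| ->
  exists F : {set {set T}},
    [/\ F \subset E, #|F| = k & #|B :|: cover F| <= #|B| + k].
Proof.
move=> burnB; elim: k => [_ | k IHk ltkE].
  by exists set0; rewrite sub0set cards0 /cover big_set0 setU0 addn0.
have [F [subFE cardF leF]] := IHk (ltnW ltkE).
have [|h hEF le1] := @next_burning_edge _ E F B burnB.
  by rewrite properEcard subFE cardF.
have /andP[hF hE] : (h \notin F) && (h \in E) by rewrite -in_setD.
exists (h |: F); split; first by rewrite subUset sub1set hE.
  by rewrite cardsU1 hF cardF.
rewrite /cover big_setU1 //= -/(cover F) setUCA.
have := cardsUI h (B :|: cover F); have := cardsID (B :|: cover F) h; lia.
Qed.

Lemma card_setI_cover (T : finType) (F : {set {set T}}) (h : {set T}) :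
  {in F, forall g, #|h :&: g| <= 1} -> #|h :&: cover F| <= #|F|.
Proof.
move=> le1; rewrite /cover big_distrr /= -[leqRHS]sum1_card.
apply: leq_trans (_ : \sum_(g in F) #|h :&: g| <= _); last exact: leq_sum.
elim/big_rec2: _ => [|g n A _ leA]; first by rewrite cards0.
by rewrite (leq_trans (leq_card_setU _ _)) // leq_add2l.
Qed.

(** Removing one edge [h] leaves [n] edges, each sharing at most one vertex with [h], so [h]
    contributes at least [r - n] new vertices. Moving the binomial to the right avoids truncated
    subtraction. *)
Lemma leq_card_cover (T : finType) (F : {set {set T}}) (r : nat) :
  linear_hypergraph F -> {in F, forall h : {set T}, r <= #|h|} ->
  r * #|F| <= #|cover F| + 'C(#|F|, 2).
Proof.
move: {2}#|F| (erefl #|F|) => n; elim: n F => [|n IHn] F cardF linF leF.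
  by rewrite cardF muln0.
have /card_gt0P[h hF] : 0 < #|F| by rewrite cardF.
have subF : {subset F :\ h <= F} by move=> g /setD1P[].
have cardFh : #|F :\ h| = n by move: cardF; rewrite (cardsD1 h) hF => -[].
have := IHn _ cardFh (sub_in2 subF linF) (sub_in1 subF leF).
have : #|h :&: cover (F :\ h)| <= #|F :\ h|.
  apply: card_setI_cover => g /setD1P[neq_gh gF].
  by apply: linF; rewrite // eq_sym.
rewrite cardFh cardF => leI leIH.
have cover_h : cover F = h :|: cover (F :\ h) by rewrite /cover (big_setD1 h).
have := cardsUI h (cover (F :\ h)); rewrite -cover_h binS bin1.
have := leF h hF; lia.
Qed.

Theorem theorem2p11 (T : finType) (E : {set {set T}}) (r : nat)
    (linear_E : linear_hypergraph E)
    (card_edge : forall h : {set T}, h \in E -> r <= #|h|)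
    (card_E : r <= #|E|) :
  'C(r, 2) <= lazy_burning_number E.
Proof.
have [[B burnB <-] _] := lazy_burning_number_min E.
have [F [/subsetP subFE cardF leBF]] := burning_edge_selection burnB card_E.
have := leq_card_cover (sub_in2 subFE linear_E) (sub_in1 subFE card_edge).
have leF : #|cover F| <= #|B| + r.
  exact: leq_trans (subset_leq_card (subsetUr _ _)) leBF.
rewrite cardF => /leq_trans/(_ (leq_add leF (leqnn _))).
(* Cancelling ['C(r, 2) + r] in [r * r <= #|B| + r + 'C(r, 2)] leaves the claim. *)
have : r * r = 'C(r, 2) + 'C(r, 2) + r.
  by elim: (r) => // n IHn; rewrite binS bin1; nia.
lia.
Qed.
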